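(* Let $h\colon L^\infty(\mathbb S_1)\to\mathbb R$ be boundedness-preserving (maps bounded sets to bounded sets) and satisfy $h(g\circ\phi_{\mathbf A})=h(g)$ for all $g\in L^\infty(\mathbb S_1)$ and all $\mathbf A\in\mathrm{GL}(2)$, where $\phi_{\mathbf A}(\theta)=\mathbf A^\top\theta/\|\mathbf A^\top\theta\|$. Let $\mu_0,\nu_0\in\mathcal P_c^*(\mathbb R^2)$ satisfy $\mathcal N_h[\mu_0]\neq\mathcal N_h[\nu_0]$, and consider $$\mathbb F=\{(\mathbf A\cdot+\mathbf y)_\#\mu_0 : \mathbf A\in\mathrm{GL}(2),\ \mathbf y\in\mathbb R^2\},\qquad \mathbb G=\{(\mathbf A\cdot+\mathbf y)_\#\nu_0 : \mathbf A\in\mathrm{GL}(2),\ \mathbf y\in\mathbb R^2\}.$$ Then $\mathbb F\subset\mathcal P_c^*(\mathbb R^2)$ and $\mathbb G\subset\mathcal P_c^*(\mathbb R^2)$, and $\mathcal N_h[\mathbb F]$ and $\mathcal N_h[\mathbb G]$ are linearly separable in $L^\infty_\rho(\mathbb R)$.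
   Context: Let $\mathbb S_1=\{x\in\mathbb R^2:\|x\|=1\}$. For $\theta\in\mathbb S_1$ let $S_\theta(x)=\langle x,\theta\rangle$ and, for a finite Borel measure $\mu$ on $\mathbb R^2$, let $\mathcal R_\theta[\mu]=(S_\theta)_\#\mu$. Fix a reference Borel probability measure $\rho$ on $\mathbb R$ without atoms. For a probability measure $\nu$ on $\mathbb R$ with $F_\nu(t)=\nu((-\infty,t])$, set $F_\nu^{[-1]}(t)=\inf\{s: F_\nu(s)>t\}$ and define the CDT $\hat\nu=F_\nu^{[-1]}\circ F_\rho$; write $\widehat{\mathcal R}_\theta[\mu]$ for the CDT of $\mathcal R_\theta[\mu]$. For $g\in L^2_\rho(\mathbb R)$, $\operatorname{mean}(g)=\int g\,\mathrm d\rho$ and $\operatorname{std}(g)=(\int|g-\operatorname{mean}(g)|^2\,\mathrm d\rho)^{1/2}$. $\mathcal P_c^*(\mathbb R^2)$ is the set of compactly supported Borel probability measures on $\mathbb R^2$ whose support is not contained in a line. For $\mu\in\mathcal P_c^*(\mathbb R^2)$: $\mathcal N[\mu](t,\theta)=\mathcal N_\theta[\mu](t)=\big(\widehat{\mathcal R}_\theta[\mu](t)-\operatorname{mean}(\widehat{\mathcal R}_\theta[\mu])\big)/\operatorname{std}(\widehat{\mathcal R}_\theta[\mu])$, and the $h$-normalized R-CDT is $\mathcal N_h[\mu](t)=h(\mathcal N[\mu](t,\cdot))$, $t\in\mathbb R$. Subsets $A,B$ of a normed space $V$ are linearly separable if there exist a continuous linear functional $\ell$ on $V$ and $c\in\mathbb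 R$ with $\ell>c$ on $A$ and $\ell<c$ on $B$.
   Formalization: For arbitrary h the function N_h[μ] need not be measurable, so the formal theorem separates in the space of all ρ-essentially bounded functions modulo ρ-a.e. equality; when N_h[μ] is measurable, restricting the functional gives separation in L^∞_ρ. *)

(* Defs.v *)
From HB Require Import structures.
From mathcomp Require Import all_boot all_order all_algebra.
From mathcomp Require Import all_classical all_reals all_analysis.
Set Implicit Arguments. Unset Strict Implicit. Unset Printing Implicit Defensive.
Import Order.TTheory GRing.Theory Num.Theory.
Import numFieldNormedType.Exports.
Local Open Scope classical_set_scope.
Local Open Scope ring_scope.

Section defs.
Variable R : realType.

(** R^2 is modelled as [R * R] (Borel product sigma-algebra, product topology). *)

Definition Sproj (th x : R * R) : R := x.1 * th.1 + x.2 * th.2.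

Definition radon (mu : set (R * R) -> \bar R) (th : R * R) : set R -> \bar R :=
  fun A => mu (Sproj th @^-1` A).

Definition cdf (nu : set R -> \bar R) (t : R) : R := fine (nu [set s | s <= t]).

Definition ginv (F : R -> R) (t : R) : R := inf [set s | t < F s].

Definition cdt (rho : set R -> \bar R) (nu : set R -> \bar R) : R -> R :=
  fun t => ginv (cdf nu) (cdf rho t).

Definition meanr (rho : probability R R) (g : R -> R) : R :=
  fine (\int[rho]_x (g x)%:E).

Definition stdr (rho : probability R R) (g : R -> R) : R :=
  Num.sqrt (fine (\int[rho]_x ((g x - meanr rho g) ^+ 2)%:E)).

(** N[mu](t, theta), as a function of theta on R^2 (only its values on the
    unit circle matter). *)
Definition Ncal (rho : probability R R) (mu : set (R * R) -> \bar R)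
    (t : R) (th : R * R) : R :=
  let g := cdt rho (radon mu th) in
  (g t - meanr rho g) / stdr rho g.

Definition Nh (h : (R * R -> R) -> R) (rho : probability R R)
    (mu : set (R * R) -> \bar R) : R -> R :=
  fun t => h (Ncal rho mu t).

Definition supp (mu : set (R * R) -> \bar R) : set (R * R) :=
  [set x | forall U : set (R * R), open U -> U x -> (0 < mu U)%E].

Definition line2 (a b c : R) : set (R * R) := [set x | a * x.1 + b * x.2 = c].

Definition Pcstar (mu : set (R * R) -> \bar R) : Prop :=
  [/\ exists P : probability (R * R)%type R, forall A, P A = mu A,
      compact (supp mu) &
      ~ (exists a b c : R, (a, b) != (0, 0) /\ supp mu `<=` line2 a b c)].

Definition affine2 (a b c d y1 y2 : R) (x : R * R) : R * R :=
  (a * x.1 + b * x.2 + y1, c * x.1 + d * x.2 + y2).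

Definition affine_orbit (mu : set (R * R) -> \bar R) :
    set (set (R * R) -> \bar R) :=
  [set nu | exists a b c d y1 y2 : R, a * d - b * c != 0 /\
            nu = (fun A => mu (affine2 a b c d y1 y2 @^-1` A))].

Definition phiA (a b c d : R) (th : R * R) : R * R :=
  let v := (a * th.1 + c * th.2, b * th.1 + d * th.2) in
  let n := Num.sqrt (v.1 ^+ 2 + v.2 ^+ 2) in (v.1 / n, v.2 / n).

(** the unit circle S_1, parametrized by angle; its (arc-length) measure
    corresponds to Lebesgue measure on the angle. *)
Definition circ (al : R) : R * R := (cos al, sin al).

Definition LinfS1 (g : R * R -> R) : Prop :=
  measurable_fun setT (g \o circ) /\
  exists M : R, {ae lebesgue_measure, forall al : R, `|g (circ al)| <= M}.

Definition aeS1_eq (g1 g2 : R * R -> R) : Prop :=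
  {ae lebesgue_measure, forall al : R, g1 (circ al) = g2 (circ al)}.

Definition wd_on_LinfS1 (h : (R * R -> R) -> R) : Prop :=
  forall g1 g2, LinfS1 g1 -> LinfS1 g2 -> aeS1_eq g1 g2 -> h g1 = h g2.

Definition bdd_preserving (h : (R * R -> R) -> R) : Prop :=
  forall B : set (R * R -> R),
    (forall g, B g -> LinfS1 g) ->
    (exists M : R, forall g, B g ->
        {ae lebesgue_measure, forall al : R, `|g (circ al)| <= M}) ->
    exists K : R, forall g, B g -> `|h g| <= K.

Definition GL2_invariant (h : (R * R -> R) -> R) : Prop :=
  forall (g : R * R -> R) (a b c d : R), LinfS1 g -> a * d - b * c != 0 ->
    h (g \o phiA a b c d) = h g.

(** L^infty_rho(R): rho-essentially bounded functions (modulo rho-a.e. equality) *)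
Definition Linf_rho (rho : probability R R) (f : R -> R) : Prop :=
  exists M : R, {ae rho, forall t : R, `|f t| <= M}.

Definition cont_lin_functional (rho : probability R R)
    (l : (R -> R) -> R) : Prop :=
  [/\ forall f g, Linf_rho rho f -> Linf_rho rho g ->
        {ae rho, forall t, f t = g t} -> l f = l g,
      forall (k : R) f g, Linf_rho rho f -> Linf_rho rho g ->
        l (fun t => k * f t + g t) = k * l f + l g &
      exists C : R, forall f (M : R),
        {ae rho, forall t, `|f t| <= M} -> `|l f| <= C * M].

Definition lin_separable (rho : probability R R) (A B : set (R -> R)) : Prop :=
  exists (l : (R -> R) -> R) (c : R), cont_lin_functional rho l /\
    (forall f, A f -> c < l f) /\ (forall f, B f -> l f < c).

End defs.

(* Main.v *)
Require Import Defs.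
From HB Require Import structures.
From mathcomp Require Import all_boot all_order all_algebra.
From mathcomp Require Import all_classical all_reals all_analysis.
From mathcomp Require Import measurable_realfun ring lra.
Import Order.TTheory GRing.Theory Num.Theory.
Import numFieldNormedType.Exports.
Local Open Scope classical_set_scope.
Local Open Scope ring_scope.

(** Since rho has no atoms, the CDT of nu pushes rho forward to nu.  Hence the
    mean and the variance of the CDT of R_theta[mu] are those of x |-> <x, theta>
    under mu, and the variance is a quadratic form in theta, positive definite
    because the support of mu is not contained in a line.  So for rho-almost
    every t the function N[mu](t, .) is measurable and bounded on the circle,
    uniformly in t, and N_h[mu] is essentially bounded.  For these t one has
    N[A mu + y](t, theta) = N[mu](t, phi_A theta), so N_h is rho-a.e. constant on
    each orbit, and it remains to separate two points f, g of L^infty_rho.  As h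
    is arbitrary, f and g need not be measurable; the limit along an ultrafilter
    containing the conull sets and some {|f - g| >= 1/n} is a continuous linear
    functional which takes different values at f and g. *)

(** * Atomless reference measures and the CDT *)

(** Continuity from below, phrased as an inequality so that the one-sided and infinite limits of a
    distribution function can be used without forming limits of [F]. *)
Lemma prob_bigcup_le d (T : measurableType d) (R : realType)
    (P : probability T R) (A : nat -> set T) (c : R) :
  (forall n, measurable (A n)) -> nondecreasing_seq A ->
  (forall n, P (A n) <= c%:E)%E -> (P (\bigcup_n A n) <= c%:E)%E.
Proof.
move=> mA ndA Ac.
have cA : P \o A @ \oo --> P (\bigcup_n A n).
  by apply: nondecreasing_cvg_mu => //; exact: bigcup_measurable.
rewrite -(cvg_lim _ cA)//; apply: lime_le.
  by apply/cvg_ex; exists (P (\bigcup_n A n)).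
by apply: nearW.
Qed.

Section distribution_function.
Context {R : realType} (P : probability R R).
Local Notation F := (Defs.cdf P).

Lemma cdfE t : (F t)%:E = P `]-oo, t]%classic.
Proof.
rewrite /Defs.cdf set_itvE; apply: fineK; apply: fin_num_measure.
by rewrite -set_itvE; exact: measurable_itv.
Qed.

Lemma prob_itvoy t : P `]t, +oo[%classic = (1 - F t)%:E.
Proof.
by rewrite -setCitvl probability_setC// EFinB cdfE.
Qed.

Lemma le_cdf s t : s <= t -> F s <= F t.
Proof.
move=> st; rewrite -lee_fin !cdfE le_measure ?inE//.
exact: subset_itvl.
Qed.

Lemma cdfR_ge0 t : 0 <= F t.
Proof. by rewrite -lee_fin cdfE. Qed.

Lemma cdfR_le1 t : F t <= 1.
Proof. by rewrite -lee_fin cdfE; exact: probability_le1. Qed.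

Lemma measurable_cdf : measurable_fun setT F.
Proof. by apply: nondecreasing_measurable => // s t; exact: le_cdf. Qed.

Let invn_le (m n : nat) : (m <= n)%N -> (n.+1%:R^-1 : R) <= m.+1%:R^-1.
Proof. by move=> mn; rewrite lef_pV2 ?posrE ?ltr0n// ler_nat. Qed.

(** Right continuity of [F]. Passing to complements turns the decreasing half-lines []-oo, s +
    1/(n+1)]] into an increasing union, as [prob_bigcup_le] requires. *)
Lemma le_cdf_at_right s c : (forall r, s < r -> c <= F r) -> c <= F s.
Proof.
move=> cF; rewrite -(lerN2 (F s)) -(lerD2l 1) -lee_fin -prob_itvoy.
have -> : `]s, +oo[%classic = \bigcup_n `]s + n.+1%:R^-1, +oo[%classic.
  apply/seteqP; split => [x/=|x [n _]/=]; rewrite !in_itv/= !andbT; last first.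
    by apply: lt_trans; rewrite ltrDl.
  move=> sx; have [n nx] := ltr_add_invr sx.
  by exists n => //=; rewrite in_itv/= andbT.
apply: prob_bigcup_le => //.
- move=> m n mn; apply/subsetPset => x/=; rewrite !in_itv/= !andbT.
  by apply: le_lt_trans; rewrite lerD2l; exact: invn_le.
- by move=> n; rewrite prob_itvoy lee_fin lerD2l lerN2 cF// ltrDl.
Qed.

Lemma cdf_le_pinfty c : (forall r, F r <= c) -> 1 <= c.
Proof.
move=> cF; rewrite -lee_fin -(probability_setT P).
have -> : [set: R] = \bigcup_n `]-oo, n%:R]%classic.
  apply/esym; rewrite -subTset => t _; exists (Num.truncn t).+1 => //=.
  by rewrite in_itv/= ltW// truncnS_gt.
apply: prob_bigcup_le => //.
- move=> m n mn; apply/subsetPset; apply: subset_itvl.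
  by rewrite bnd_simp ler_nat.
- by move=> n; rewrite -cdfE lee_fin.
Qed.

Lemma le_cdf_ninfty c : (forall r, c <= F r) -> c <= 0.
Proof.
move=> cF; have : (1%:E <= (1 - c)%:E)%E; last by rewrite lee_fin; lra.
rewrite -(probability_setT P).
have -> : [set: R] = \bigcup_n `]- n%:R, +oo[%classic.
  apply/esym; rewrite -subTset => t _; exists (Num.truncn (- t)).+1 => //=.
  by rewrite in_itv/= andbT ltrNl truncnS_gt.
apply: prob_bigcup_le => //.
- move=> m n mn; apply/subsetPset => x/=; rewrite !in_itv/= !andbT.
  by apply: le_lt_trans; rewrite lerN2 ler_nat.
- by move=> n; rewrite prob_itvoy lee_fin; have := cF (- n%:R); lra.
Qed.

Section atomless.
Hypothesis P1 : forall x, P [set x] = 0%E.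

(** The absence of atoms enters here: the endpoint carries no mass, so [F] is also left
    continuous. *)
Lemma prob_itvNyo t : P `]-oo, t[%classic = (F t)%:E.
Proof.
rewrite cdfE -(@setUitv1 _ _ _ _ true)//.
rewrite measureU//.
  by rewrite [X in (_ + X)%E](_ : _ = 0%E) ?adde0//; exact: P1.
by apply/seteqP; split => // x/= [+ xt]; rewrite xt in_itv/= ltxx.
Qed.

Lemma cdf_le_at_left s c : (forall r, r < s -> F r <= c) -> F s <= c.
Proof.
move=> cF; rewrite -lee_fin -prob_itvNyo.
rewrite (_ : `]-oo, s[%classic = \bigcup_n `]-oo, s - n.+1%:R^-1]%classic).
  apply: prob_bigcup_le => //.
  - move=> m n mn; apply/subsetPset; apply: subset_itvl.
    by rewrite bnd_simp lerD2l lerN2; exact: invn_le.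
  - by move=> n; rewrite -cdfE lee_fin cF// ltrBlDr ltrDl.
apply/seteqP; split => [x/=|x [n _]/=]; rewrite !in_itv/=; last first.
  by move=> /le_lt_trans; apply; rewrite ltrBlDr ltrDl.
move=> xs; have [n nx] := ltr_add_invr xs.
by exists n => //=; rewrite in_itv/= lerBrDr ltW.
Qed.

Lemma measurable_cdf_lt c : measurable [set t | F t < c].
Proof.
rewrite -[X in measurable X]setTI (_ : [set t | _] = F @^-1` `]-oo, c[).
  by apply: measurable_cdf => //; exact: measurable_itv.
by apply/seteqP; split => x/=; rewrite in_itv.
Qed.

Lemma measurable_cdf_le c : measurable [set t | F t <= c].
Proof.
rewrite -[X in measurable X]setTI (_ : [set t | _] = F @^-1` `]-oo, c]).
  by apply: measurable_cdf => //; exact: measurable_itv.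
by apply/seteqP; split => x/=; rewrite in_itv.
Qed.

(** Half of the fact that [F] is uniformly distributed on [0, 1] under [P]. If the sublevel set has
    a supremum s, it lies in []-oo, s]] and [F s <= c] by left continuity; if it is unbounded above,
    [F <= c] everywhere and hence [1 <= c]. *)
Lemma prob_cdf_le (c : R) : 0 <= c -> (P [set t | (F t <= c)%R] <= c%:E)%E.
Proof.
move=> c0; have [->|/set0P S0] := eqVneq [set t | F t <= c] set0.
  by rewrite measure0.
have [hS|hS] := pselect (has_ubound [set t | F t <= c]); last first.
  apply: (le_trans (probability_le1 _ _)); first exact: measurable_cdf_le.
  rewrite lee_fin; apply: cdf_le_pinfty => r; rewrite leNgt; apply/negP => cr.
  apply: hS; exists r => t/= tc; rewrite leNgt; apply/negP => rt.
  by have := le_cdf _ _ (ltW rt); lra.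
apply: (@le_trans _ _ (F (sup [set t | F t <= c]))%:E); last first.
  rewrite lee_fin; apply: cdf_le_at_left => r rs.
  have [t/= tc rt] := sup_gt S0 rs.
  by rewrite (le_trans _ tc)// le_cdf// ltW.
rewrite cdfE le_measure ?inE//; first exact: measurable_cdf_le.
by move=> t/= tc; rewrite in_itv/=; exact: ub_le_sup.
Qed.

(** The other half, by the mirrored argument: the open half-line left of the infimum s of [c <= F]
    lies in the set, and [c <= F s] by right continuity. *)
Lemma prob_cdf_lt (c : R) : c <= 1 -> (c%:E <= P [set t | (F t < c)%R])%E.
Proof.
move=> c1; have [S0|/set0P S0] := eqVneq [set t | c <= F t] set0.
  rewrite (_ : mkset _ = setT) ?probability_setT//.
  rewrite -subTset => t _ /=; rewrite ltNge; apply/negP => ct.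
  by have : set0 t by rewrite -S0.
have [hS|hS] := pselect (has_lbound [set t | c <= F t]); last first.
  apply: (@le_trans _ _ 0%E) => //; rewrite lee_fin.
  apply: le_cdf_ninfty => r; rewrite leNgt; apply/negP => cr.
  apply: hS; exists r => t/= tc; rewrite leNgt; apply/negP => rt.
  by have := le_cdf _ _ (ltW rt); lra.
apply: (@le_trans _ _ (F (inf [set t | c <= F t]))%:E).
  rewrite lee_fin; apply: le_cdf_at_right => r rs.
  have [t/= tc rt] := inf_lt S0 rs.
  by rewrite (le_trans tc)// le_cdf// ltW.
rewrite -prob_itvNyo le_measure ?inE//; first exact: measurable_cdf_lt.
move=> t/=; rewrite in_itv/= => tS; rewrite ltNge; apply/negP => ct.
by have := ge_inf hS ct; rewrite leNgt tS.
Qed.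

(** Outside this set [ginv (Defs.cdf nu) (F t)] may be the infimum of an empty or
    unbounded set, which is [0] by convention. *)
Definition cdf_interior : set R := [set t | 0 < F t < 1].

Lemma measurable_cdf_interior : measurable cdf_interior.
Proof.
rewrite (_ : cdf_interior = [set t | F t < 1] `\` [set t | F t <= 0]).
  by apply: measurableD; [exact: measurable_cdf_lt|exact: measurable_cdf_le].
apply/seteqP; split => t; rewrite /cdf_interior/=.
  by move=> /andP[? ?]; split => //; apply/negP; rewrite -ltNge.
by move=> [-> /negP]; rewrite -ltNge => ->.
Qed.

Lemma ae_cdf_interior : {ae P, forall t, cdf_interior t}.
Proof.
exists ([set t | F t <= 0] `|` ~` [set t | F t < 1]); split.
- apply: measurableU; first exact: measurable_cdf_le.
  by apply: measurableC; exact: measurable_cdf_lt.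
- apply/eqP; rewrite eq_le measure_ge0 andbT.
  apply: (le_trans (measureU2 _ _ _)).
  - exact: measurable_cdf_le.
  - by apply: measurableC; exact: measurable_cdf_lt.
  rewrite -[X in (_ <= X)%E]adde0; apply: leeD; first exact: prob_cdf_le.
  rewrite [leLHS](probability_setC P (measurable_cdf_lt 1)).
  by rewrite sube_le0; exact: prob_cdf_lt.
- move=> t /= nt; apply: contrapT => /not_orP[/= /negP].
  by rewrite -ltNge => t0 /contrapT t1; apply: nt; rewrite /cdf_interior/= t0.
Qed.

End atomless.

(** For [0 < u < 1] the limits of [F] at infinity make the set in [ginv] nonempty and bounded below,
    so [inf] is a genuine infimum. Bounds, measurability and equivariance of the CDT all rest on
    this equivalence. *)
Lemma ginv_ltP u a : 0 < u < 1 -> ginv F u < a <-> exists2 s, s < a & u < F s.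
Proof.
move=> /andP[u0 u1].
have S0 : [set s | u < F s] !=set0.
  apply: contrapT => S0; suff : 1 <= u by lra.
  apply: cdf_le_pinfty => r; rewrite leNgt; apply/negP => ur.
  by apply: S0; exists r.
split=> [|[s sa us]]; first by move=> /(inf_lt S0)[s/= us sa]; exists s.
apply: le_lt_trans sa; apply: ge_inf => //.
apply: contrapT => hS; suff : u <= 0 by lra.
apply: le_cdf_ninfty => r; rewrite leNgt; apply/negP => ru; apply: hS.
exists r => t/= ut; rewrite leNgt; apply/negP => rt.
by have := le_cdf _ _ (ltW rt); lra.
Qed.

Lemma ginv_bounds u K : 0 < u < 1 -> P `[- K, K]%classic = 1%E -> - K <= ginv F u <= K.
Proof.
move=> u01 PK; apply/andP; split.
  rewrite leNgt; apply/negP => /(ginv_ltP _ _ u01)[s sK us].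
  suff : F s <= 0 by case/andP: u01; lra.
  rewrite -lee_fin cdfE (@le_trans _ _ (P (~` `[- K, K])))//.
    rewrite le_measure ?inE//; first exact: measurableC.
    by move=> x/=; rewrite !in_itv/= => xs /andP[]; lra.
  by rewrite probability_setC// PK subee.
rewrite leNgt; apply/negP => Kg.
suff /(ginv_ltP _ _ u01) : exists2 s, s < ginv F u & u < F s by rewrite ltxx.
exists K => //; case/andP : u01 => _ /lt_le_trans; apply.
rewrite -lee_fin cdfE -PK le_measure ?inE//.
by move=> x/=; rewrite !in_itv/= => /andP[].
Qed.

End distribution_function.

(** Both the measure and the level depend on the parameter, so that the lemma serves the CDT as a
    function of t and, for fixed t, as a function of the angle. Since distribution functions are
    monotone, the witness in [ginv_ltP] may be taken rational, which makes the sublevel sets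
    countable unions. *)
Lemma measurable_fun_ginv d (T : measurableType d) (R : realType)
    (nu : T -> probability R R) (u : T -> R) (D : set T) :
  (forall x, D x -> 0 < u x < 1) ->
  (forall s, measurable_fun D (fun x => Defs.cdf (nu x) s)) ->
  measurable_fun D u ->
  measurable_fun D (fun x => ginv (Defs.cdf (nu x)) (u x)).
Proof.
move=> Du mF mu mD; move: (mD).
apply: (measurability (@RGenInftyO.G R)); first exact: RGenInftyO.measurableE.
move=> _ [_ [a ->] <-].
rewrite (_ : _ `&` _ = \bigcup_q (D `&`
    [set x | (ratr q < a) && (u x < Defs.cdf (nu x) (ratr q))])).
  apply: bigcupT_measurable_rat => q; have [qa|qa] := ltP (ratr q) a.
    have := measurable_fun_ltr mu (mF (ratr q)) mD (Y := [set true]).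
    by apply.
  by rewrite (_ : mkset _ = set0) ?setI0//; apply/seteqP; split.
apply/seteqP; split => x /=; rewrite in_itv/=.
  move=> [Dx /(ginv_ltP _ _ _ (Du _ Dx))[s sa us]].
  have [q] := rat_in_itvoo sa; rewrite in_itv/= => /andP[sq qa].
  exists q => //; split => //=; rewrite qa/= (lt_le_trans us)//.
  by apply: le_cdf; exact: ltW.
move=> [q _ [Dx /= /andP[qa uq]]]; split=> //.
by apply/(ginv_ltP _ _ _ (Du _ Dx)); exists (ratr q).
Qed.

(** * The CDT as a transport map from rho to nu *)

Section cdt.
Context {R : realType} (rho nu : probability R R).
Hypothesis rho1 : forall x, rho [set x] = 0%E.

Lemma measurable_cdt : measurable_fun setT (cdt rho nu).
Proof.
have -> : [set: R] = cdf_interior rho `|` ([set t | Defs.cdf rho t <= 0] `|`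
    ~` [set t | Defs.cdf rho t < 1]).
  (* On the two pieces outside [cdf_interior] the level is exactly 0 or 1, so the CDT is constant
     there. *)
  apply/esym; rewrite -subTset => t _; rewrite /cdf_interior/=.
  have [] := ltP 0 (Defs.cdf rho t); last by right; left.
  by have [] := ltP (Defs.cdf rho t) 1; [left|right; right].
have m0 := measurable_cdf_le rho 0.
have m1 : measurable (~` [set t | Defs.cdf rho t < 1]).
  by apply: measurableC; exact: measurable_cdf_lt.
have mi := measurable_cdf_interior rho.
apply/measurable_funU; [by []|exact: measurableU|split].
  apply: (measurable_fun_ginv _ _ _ (fun=> nu)) => //.
  by apply: measurable_funTS; exact: measurable_cdf.
apply/measurable_funU => //; split.
  apply: (eq_measurable_fun (cst (ginv (Defs.cdf nu) 0))) => // t.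
  rewrite inE/= => t0; congr ginv; apply/eqP.
  by rewrite eq_le t0 cdfR_ge0.
apply: (eq_measurable_fun (cst (ginv (Defs.cdf nu) 1))) => // t.
rewrite inE/= => /negP; rewrite -leNgt => t1; congr ginv; apply/eqP.
by rewrite eq_le t1 cdfR_le1.
Qed.

(** Sandwiches the event [cdt rho nu t <= x] between a strict and a weak inequality of distribution
    functions; [prob_cdf_lt] and [prob_cdf_le] then bound its probability from both sides by the
    same number. *)
Lemma cdt_le_mono t x : cdf_interior rho t ->
  (Defs.cdf rho t < Defs.cdf nu x -> cdt rho nu t <= x) /\
  (cdt rho nu t <= x -> Defs.cdf rho t <= Defs.cdf nu x).
Proof.
move=> it; split => [tx|tx].
  apply/ler_addgt0Pr => e e0; apply: ltW; apply/ginv_ltP => //.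
  by exists x => //; rewrite ltrDl.
apply: le_cdf_at_right => r xr.
have /(ginv_ltP _ _ _ it)[s sr ts] := le_lt_trans tx xr.
by rewrite (le_trans (ltW ts))// le_cdf// ltW.
Qed.

Lemma prob_cdt_le x : rho (cdt rho nu @^-1` `]-oo, x]%classic) = (Defs.cdf nu x)%:E.
Proof.
have mS : measurable (cdt rho nu @^-1` `]-oo, x]%classic).
  by rewrite -[X in measurable X]setTI; apply: measurable_cdt.
have mi := measurable_cdf_interior rho.
have rD A : measurable A -> rho A = rho (A `&` cdf_interior rho).
  move=> mA; have [N [mN N0 iN]] := ae_cdf_interior rho rho1.
  rewrite (measureDI rho mA mi) [X in (X + _)%E](_ : _ = 0%E) ?add0e//.
  apply: (subset_measure0 _ mN _ N0) => //; first exact: measurableD.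
  by move=> t [_]; exact: iN.
apply/eqP; rewrite eq_le; apply/andP; split.
  apply: (le_trans _ (prob_cdf_le _ rho1 _ (cdfR_ge0 nu x))).
  rewrite rD// le_measure ?inE//; [exact: measurableI|exact: measurable_cdf_le|].
  by move=> t [/= + it]; rewrite in_itv/=; exact: (cdt_le_mono _ _ it).2.
apply: (le_trans (prob_cdf_lt _ rho1 _ (cdfR_le1 nu x))).
rewrite rD; last exact: measurable_cdf_lt.
rewrite le_measure ?inE//; first apply: measurableI => //.
  exact: measurable_cdf_lt.
by move=> t [/= + it]; rewrite in_itv/=; exact: (cdt_le_mono _ _ it).1.
Qed.

Lemma pushforward_cdt A : measurable A -> pushforward rho (cdt rho nu) A = nu A.
Proof.
pose X : {RV rho >-> R} := HB.pack (cdt rho nu)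
  (isMeasurableFun.Build _ _ _ _ (cdt rho nu) measurable_cdt).
move=> mA; rewrite -/(distribution rho X A).
(* Two probability measures that agree on the half-lines []x, +oo[] coincide, because these are
   stable under intersection and generate the Borel sets. *)
apply: (measure_unique (@RGenOInfty.G R) (fun n => `]- n%:R, +oo[%classic)) => //.
- exact: RGenOInfty.measurableE.
- move=> _ _ [x ->] [y ->]; exists (Num.max x y).
  by apply/seteqP; split => z/=; rewrite !in_itv/= !andbT gt_max => /andP.
- by move=> n; exists (- n%:R).
- rewrite -subTset => t _; exists (Num.truncn (- t)).+1 => //=.
  by rewrite in_itv/= andbT ltrNl truncnS_gt.
- move=> _ [x ->]; apply/esym; apply: (etrans (prob_itvoy nu x)).
  rewrite -setCitvl EFinB -prob_cdt_le; apply/esym.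
  exact: (probability_setC (distribution rho X)).
- by move=> k; rewrite (le_lt_trans (probability_le1 _ _)) ?ltry.
Qed.

End cdt.

(** * Planar measures and their projections *)

Section open_measurable_prod.
Context {R : realType}.

(** A countable base of the topology of the plane. It reduces arbitrary unions of open sets to
    countable ones. *)
Definition rat_box (q : (rat * rat) * (rat * rat)) : set (R * R) :=
  `]ratr q.1.1, ratr q.1.2[%classic `*` `]ratr q.2.1, ratr q.2.2[%classic.

Lemma measurable_rat_box q : measurable (rat_box q).
Proof. by apply: measurableX. Qed.

Lemma rat_box_nbhs (U : set (R * R)) x : open U -> U x ->
  exists2 q, rat_box q x & rat_box q `<=` U.
Proof.
move=> oU Ux; have /nbhs_ballP[e /= e0 eU] : nbhs x U by exact: open_nbhs_nbhs.
have near_rat (z : R) : exists q : rat * rat,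
    [/\ z - e < ratr q.1, ratr q.1 < z, z < ratr q.2 & ratr q.2 < z + e].
  have [q1] := @rat_in_itvoo R (z - e) z ltac:(lra).
  have [q2] := @rat_in_itvoo R z (z + e) ltac:(lra).
  by rewrite !in_itv/= => /andP[? ?] /andP[? ?]; exists (q1, q2).
have [q [q1 q2 q3 q4]] := near_rat x.1; have [r [r1 r2 r3 r4]] := near_rat x.2.
exists (q, r); first by split; rewrite /= in_itv/=; apply/andP.
move=> y [/=]; rewrite !in_itv/= => /andP[? ?] /andP[? ?]; apply: eU.
by split; rewrite /ball/= ltr_norml; lra.
Qed.

Lemma open_rat_box (U : set (R * R)) : open U ->
  U = \bigcup_q (if `[< rat_box q `<=` U >] then rat_box q else set0).
Proof.
move=> oU; apply/seteqP; split => [x Ux|x [q _]]; last first.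
  by case: asboolP => // qU; exact: qU.
have [q qx qU] := rat_box_nbhs _ _ oU Ux; exists q => //.
by case: asboolP.
Qed.

Lemma open_measurable_prod (U : set (R * R)) : open U -> measurable U.
Proof.
move=> oU; rewrite (open_rat_box _ oU).
apply: countable_bigcupT_measurable; first exact: countableP.
by move=> q; case: ifP => // _; exact: measurable_rat_box.
Qed.

(** Each point outside the support lies in a rational box of measure zero, and there are only
    countably many boxes. *)
Lemma negligible_supp (P : probability (R * R)%type R) : P.-negligible (~` supp P).
Proof.
pose A (q : (rat * rat) * (rat * rat)) : set (R * R) :=
  if P (rat_box q) == 0%E then rat_box q else set0.
pose B n := if unpickle n is Some q then A q else set0.
suff : P.-negligible (\bigcup_n B n).
  apply: negligibleS => x /existsNP[U /not_implyP[oU /not_implyP[Ux PU]]].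
  have [q qx qU] := rat_box_nbhs _ _ oU Ux.
  exists (pickle q); first exact: I.
  rewrite /B pickleK /A; suff -> : P (rat_box q) == 0%E by [].
  rewrite eq_le measure_ge0 andbT (@le_trans _ _ (P U))//.
    rewrite le_measure ?inE//; first exact: measurable_rat_box.
    exact: open_measurable_prod.
  by rewrite leNgt; exact/negP.
apply: negligible_bigcup => n; rewrite /B; case: unpickle => [q|]; last first.
  exact: negligible_set0.
rewrite /A; case: eqP => [q0|_]; last exact: negligible_set0.
by apply/negligibleP => //; exact: measurable_rat_box.
Qed.

Definition square (K : R) : set (R * R) := `[- K, K]%classic `*` `[- K, K]%classic.

Lemma measurable_square K : measurable (square K).
Proof. by apply: measurableX. Qed.

(** The moment estimates and uniform bounds below use compactness of the support only in this
    form. *)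
Lemma compact_supp_square (P : probability (R * R)%type R) :
  compact (supp P) -> exists K : R, P (square K) = 1%E.
Proof.
move=> /compact_bounded[K [_ hK]].
exists (`|K| + 1).
apply/eqP; rewrite eq_le probability_le1/=; last exact: measurable_square.
have mC := measurableC (measurable_square (`|K| + 1)).
rewrite -(setCK (square _)) probability_setC// (_ : P (~` _) = 0%E) ?sube0//.
apply/negligibleP => //; apply: negligibleS (negligible_supp P).
move=> x xs suppx; apply: xs; have K1 : K < `|K| + 1 by have := ler_norm K; lra.
have := hK _ K1 x suppx; rewrite /= prod_normE/= ge_max => /andP[? ?].
by split; rewrite /= in_itv/= -ler_norml.
Qed.

End open_measurable_prod.

Section projection.
Context {R : realType}.

Lemma measurable_Sproj (th : R * R) : measurable_fun setT (Sproj th).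
Proof.
by apply: measurable_funD; apply: measurable_funM.
Qed.

HB.instance Definition _ th := isMeasurableFun.Build _ _ _ _ (Sproj th)
  (measurable_Sproj th).

(** Convertible to [radon P th], with its structure of probability measure. *)
Definition radon_prob (P : probability (R * R)%type R) (th : R * R) :
    probability R R :=
  distribution P (Sproj th).

End projection.

Section moments.
Context {R : realType} (P : probability (R * R)%type R) (K : R).
Hypothesis PK : P (square K) = 1%E.
Local Notation E f := (\int[P]_x f x).

(** Linear and quadratic functions are unbounded on the plane, but a bound on a set of full measure
    suffices. *)
Lemma integrable_square (f : R * R -> R) : measurable_fun setT f ->
  (exists M, forall x, square K x -> `|f x| <= M) ->
  P.-integrable setT (EFin \o f).
Proof.
move=> mf [M fM]; have mS := measurable_square K.
apply/(negligible_integrable (N := ~` square K)) => //.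
- exact: measurableC.
- exact/measurable_EFinP.
- by apply: (etrans (probability_setC P mS)); rewrite PK subee.
rewrite setTD setCK; apply: measurable_bounded_integrable => //.
- by apply: (@le_lt_trans _ _ 1%E); rewrite ?ltry// -PK.
- exact: measurable_funTS.
- exists M; split; first exact: num_real.
  by move=> r Mr x /fM /le_trans; apply; exact: ltW.
Qed.

Definition bary : R * R := (E fst, E snd).

Lemma bounded_fst x : square K x -> `|x.1| <= K.
Proof. by case; rewrite /= !in_itv/= -!ler_norml. Qed.

Lemma bounded_snd x : square K x -> `|x.2| <= K.
Proof. by case; rewrite /= !in_itv/= -!ler_norml. Qed.

Lemma bounded_Sproj th x : square K x -> `|Sproj th x| <= K * (`|th.1| + `|th.2|).
Proof.
move=> Kx; rewrite (le_trans (ler_normD _ _))// !normrM mulrDr.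
by apply: lerD; apply: ler_wpM2r => //; [exact: bounded_fst|exact: bounded_snd].
Qed.

Lemma integrable_fst : P.-integrable setT (EFin \o fst).
Proof.
by apply: integrable_square; [exact: measurable_fst|exists K; exact: bounded_fst].
Qed.

Lemma integrable_snd : P.-integrable setT (EFin \o snd).
Proof.
by apply: integrable_square; [exact: measurable_snd|exists K; exact: bounded_snd].
Qed.

Lemma integrable_Sproj th : P.-integrable setT (EFin \o Sproj th).
Proof.
apply: integrable_square; first exact: measurable_Sproj.
by exists (K * (`|th.1| + `|th.2|)) => x; exact: bounded_Sproj.
Qed.

Lemma Rintegral_Sproj th : E (Sproj th) = Sproj th bary.
Proof.
have i1 := integrable_fst; have i2 := integrable_snd.
rewrite /Sproj RintegralD//.
- by rewrite !RintegralZr.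
- exact: integrableZr i1.
- exact: integrableZr i2.
Qed.

End moments.

(** * Moments of the CDT *)

Section cdt_integral.
Context {R : realType} (rho nu : probability R R).
Hypothesis rho1 : forall x, rho [set x] = 0%E.

HB.instance Definition _ := isMeasurableFun.Build _ _ _ _
  (cdt rho nu) (measurable_cdt rho nu).

Lemma eq_integral_cdt (f : R -> \bar R) :
  (\int[distribution rho (cdt rho nu)]_y f y = \int[nu]_y f y)%E.
Proof.
apply: eq_measure_integral => A mA _.
exact: (pushforward_cdt rho nu rho1 A mA).
Qed.

Lemma integral_cdt (f : R -> \bar R) : measurable_fun setT f ->
  nu.-integrable setT f ->
  (\int[rho]_t f (cdt rho nu t) = \int[nu]_y f y)%E.
Proof.
move=> mf /integrableP[_ fi].
rewrite -eq_integral_cdt integral_distribution//.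
apply/integrableP; split; first exact: measurableT_comp.
rewrite -(ge0_integral_distribution (cdt rho nu) (f := abse \o f))//.
- by rewrite eq_integral_cdt.
- exact: measurableT_comp.
- by move=> y; exact: abse_ge0.
Qed.

End cdt_integral.

Lemma measurable_sqr_dev d (T : measurableType d) (R : realType) (f : T -> R)
    (c : R) :
  measurable_fun setT f -> measurable_fun setT (fun x => (f x - c) ^+ 2).
Proof. by move=> mf; apply: measurable_funX; exact: measurable_funB. Qed.

Section cdt_moments.
Context {R : realType} (rho : probability R R)
  (P : probability (R * R)%type R) (K : R).
Hypothesis rho1 : forall x, rho [set x] = 0%E.
Hypothesis PK : P (square K) = 1%E.
Local Notation E f := (\int[P]_x f x).

(** Two changes of variables: along the CDT from [rho] to the projected measure, then along
    [Sproj th] back to [P]. The moments of the CDT are thus independent of [rho]. *)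
Lemma Rintegral_cdt_radon th (f : R -> R) : measurable_fun setT f ->
  P.-integrable setT (EFin \o (f \o Sproj th)) ->
  \int[rho]_t f (cdt rho (radon P th) t) = E (f \o Sproj th).
Proof.
move=> mf fi; congr fine.
have mf' : measurable_fun setT (EFin \o f) by exact/measurable_EFinP.
transitivity (\int[radon_prob P th]_y (EFin \o f) y)%E; last first.
  by rewrite /radon_prob integral_distribution.
rewrite -(integral_cdt rho _ rho1 _ mf')//.
apply/integrableP; split => //; case/integrableP : fi => _.
rewrite /radon_prob (ge0_integral_distribution _ (f := abse \o (EFin \o f)))//.
  exact: measurableT_comp.
by move=> y; exact: abse_ge0.
Qed.

Definition proj_variance (th : R * R) : R :=
  E (fun x => (Sproj th x - Sproj th (bary P)) ^+ 2).

Lemma mean_cdt_radon th : meanr rho (cdt rho (radon P th)) = Sproj th (bary P).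
Proof.
rewrite -(Rintegral_Sproj P K PK).
apply: (Rintegral_cdt_radon th (fun y => y)); first exact: measurable_id.
exact: integrable_Sproj PK th.
Qed.

Let bounded_dev (f : R * R -> R) c M x : `|f x| <= M -> `|f x - c| <= M + `|c|.
Proof. by move=> fM; rewrite (le_trans (ler_normB _ _))// lerD2r. Qed.

Let bounded_mul (u v M N : R) : `|u| <= M -> `|v| <= N -> `|u * v| <= M * N.
Proof. by move=> uM vN; rewrite normrM ler_pM. Qed.

Lemma integrable_dev th :
  P.-integrable setT (EFin \o (fun x => (Sproj th x - Sproj th (bary P)) ^+ 2)).
Proof.
apply: (integrable_square P K PK).
  exact: measurable_sqr_dev (measurable_Sproj th).
set M := K * (`|th.1| + `|th.2|) + `|Sproj th (bary P)|.
exists (M * M) => x Kx; rewrite expr2.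
by apply: bounded_mul; apply: bounded_dev; exact: bounded_Sproj Kx.
Qed.

Lemma std_cdt_radon th :
  stdr rho (cdt rho (radon P th)) = Num.sqrt (proj_variance th).
Proof.
rewrite /stdr mean_cdt_radon; congr Num.sqrt.
apply: (Rintegral_cdt_radon th (fun y => (y - Sproj th (bary P)) ^+ 2)).
  exact: (measurable_sqr_dev _ R R (fun y => y)).
exact: integrable_dev.
Qed.

(** The coefficients are the entries of the covariance matrix of [P]. *)
Lemma proj_variance_quadratic : exists a b c : R, forall th,
  proj_variance th = a * th.1 ^+ 2 + 2 * b * (th.1 * th.2) + c * th.2 ^+ 2.
Proof.
set m := bary P.
have mf : measurable_fun setT (fun x : R * R => x.1 - m.1)
  by exact: measurable_funB.
have mg : measurable_fun setT (fun x : R * R => x.2 - m.2)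
  by exact: measurable_funB.
have bf x : square K x -> `|x.1 - m.1| <= K + `|m.1|.
  by move=> Kx; apply: (bounded_dev fst); exact: bounded_fst Kx.
have bg x : square K x -> `|x.2 - m.2| <= K + `|m.2|.
  by move=> Kx; apply: (bounded_dev snd); exact: bounded_snd Kx.
have ia : P.-integrable setT (EFin \o fun x => (x.1 - m.1) * (x.1 - m.1)).
  apply: (integrable_square P K PK); first exact: measurable_funM.
  exists ((K + `|m.1|) * (K + `|m.1|)) => x Kx.
  by apply: bounded_mul; exact: bf.
have ib : P.-integrable setT (EFin \o fun x => (x.1 - m.1) * (x.2 - m.2)).
  apply: (integrable_square P K PK); first exact: measurable_funM.
  exists ((K + `|m.1|) * (K + `|m.2|)) => x Kx.
  by apply: bounded_mul; [exact: bf|exact: bg].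
have ic : P.-integrable setT (EFin \o fun x => (x.2 - m.2) * (x.2 - m.2)).
  apply: (integrable_square P K PK); first exact: measurable_funM.
  exists ((K + `|m.2|) * (K + `|m.2|)) => x Kx.
  by apply: bounded_mul; exact: bg.
exists (E (fun x => (x.1 - m.1) * (x.1 - m.1))),
  (E (fun x => (x.1 - m.1) * (x.2 - m.2))),
  (E (fun x => (x.2 - m.2) * (x.2 - m.2))) => th.
set u := E (fun x => (x.1 - m.1) * (x.1 - m.1)).
set v := E (fun x => (x.1 - m.1) * (x.2 - m.2)).
set w := E (fun x => (x.2 - m.2) * (x.2 - m.2)).
transitivity (E (fun x => (th.1 ^+ 2 * ((x.1 - m.1) * (x.1 - m.1)) +
    (2 * (th.1 * th.2)) * ((x.1 - m.1) * (x.2 - m.2))) +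
    th.2 ^+ 2 * ((x.2 - m.2) * (x.2 - m.2)))).
  by apply: eq_Rintegral => x _; rewrite /Sproj; ring.
have ja := integrableZl measurableT (th.1 ^+ 2) ia.
have jb := integrableZl measurableT (2 * (th.1 * th.2)) ib.
have jc := integrableZl measurableT (th.2 ^+ 2) ic.
rewrite RintegralD//; last exact: (integrableD _ ja jb).
by rewrite RintegralD// !RintegralZl// -/u -/v -/w; ring.
Qed.

End cdt_moments.

Section proj_variance_lower_bound.
Context {R : realType} (P : probability (R * R)%type R) (K : R).
Hypothesis PK : P (square K) = 1%E.
Hypothesis nline :
  ~ (exists a b c : R, (a, b) != (0, 0) /\ supp P `<=` line2 a b c).

(** If the variance vanished, [P] would be concentrated on the line where [Sproj th] equals its
    mean. The complement of that line would be an open null set, hence free of points of the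
    support. *)
Lemma proj_variance_gt0 th : th != (0, 0) -> 0 < proj_variance P th.
Proof.
case: th => a b ab0; rewrite lt0r; apply/andP; split; last first.
  by apply: Rintegral_ge0 => x _; exact: sqr_ge0.
apply/eqP => v0; apply: nline; exists a, b, (Sproj (a, b) (bary P)); split => //.
set f := fun x => (Sproj (a, b) x - Sproj (a, b) (bary P)) ^+ 2.
have fi : P.-integrable setT (EFin \o f) by exact: (integrable_dev P K PK).
have mf : measurable_fun setT (EFin \o f) by case/integrableP : fi.
have : (\int[P]_(x in setT) `|(EFin \o f) x| = 0)%E.
  under eq_integral => x _ do rewrite gee0_abs ?lee_fin ?sqr_ge0//.
  by rewrite -(fineK (integrable_fin_num measurableT fi)); congr EFin.
move=> /(ae_eq_integral_abs _ measurableT mf)[N [mN N0 fN]].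
move=> x sx; apply: contrapT => xl.
have oU : open (~` line2 a b (Sproj (a, b) (bary P))).
  apply: closed_openC; rewrite (_ : line2 _ _ _ =
    (fun x : R * R => a * x.1 + b * x.2) @^-1` [set Sproj (a, b) (bary P)])//.
  apply: preimage_closed; last exact: closed_eq.
  move=> y _; apply: cvgD; apply: cvgM; try exact: cvg_cst.
    exact: cvg_fst.
  exact: cvg_snd.
have := sx _ oU xl; apply/negP; rewrite -leNgt -N0 le_measure ?inE//.
  exact: open_measurable_prod.
move=> y yl; apply: fN => /= /(_ I)[] /eqP; rewrite sqrf_eq0 subr_eq0 => /eqP.
by rewrite {1}/Sproj/= ![_.1 * _]mulrC ![_.2 * _]mulrC.
Qed.

(** The constant is the determinant over the trace of the covariance matrix, which is at most its
    smallest eigenvalue; no compactness of the circle is invoked. *)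
Lemma proj_variance_lower_bound : exists2 k : R, 0 < k &
  forall th, th.1 ^+ 2 + th.2 ^+ 2 = 1 -> k <= proj_variance P th.
Proof.
have [a [b [c Q]]] := proj_variance_quadratic P K PK.
have a0 : 0 < a.
  have := proj_variance_gt0 (1, 0); rewrite Q/= xpair_eqE oner_eq0/= => /(_ isT).
  by congr (_ < _); ring.
have c0 : 0 < c.
  have := proj_variance_gt0 (0, 1); rewrite Q/= xpair_eqE oner_eq0 andbF/= => /(_ isT).
  by congr (_ < _); ring.
(* In the direction [(- b, a)] the form takes the value [a * (a * c - b ^+ 2)]. *)
have d0 : 0 < a * c - b ^+ 2.
  have := proj_variance_gt0 (- b, a); rewrite Q/= xpair_eqE (gt_eqF a0) andbF/= => /(_ isT).
  rewrite (_ : _ + _ = a * (a * c - b ^+ 2));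
    last by ring.
  by rewrite pmulr_rgt0.
(* (a + c) Q(th) - (a c - b^2) |th|^2 is a sum of two squares *)
exists ((a * c - b ^+ 2) / (a + c)); first by rewrite divr_gt0// addr_gt0.
move=> th th1; rewrite Q ler_pdivrMr ?addr_gt0// -[leLHS]mulr1.
rewrite -[X in _ * X <= _]th1 -subr_ge0.
rewrite (_ : _ - _ = (a * th.1 + b * th.2) ^+ 2 + (b * th.1 + c * th.2) ^+ 2).
  by rewrite addr_ge0// sqr_ge0.
by ring.
Qed.

End proj_variance_lower_bound.

(** * The normalized R-CDT on the circle *)

Section normalized_rcdt.
Context {R : realType} (rho : probability R R)
  (P : probability (R * R)%type R) (K : R).
Hypothesis rho1 : forall x, rho [set x] = 0%E.
Hypothesis PK : P (square K) = 1%E.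
Hypothesis nline :
  ~ (exists a b c : R, (a, b) != (0, 0) /\ supp P `<=` line2 a b c).

(** Dividing by the standard deviation is written as the power [- 2^-1] of the variance, so that
    measurability in the angle comes from [measurable_powR]. *)
Lemma NcalE t th : Ncal rho P t th =
  (cdt rho (radon P th) t - Sproj th (bary P)) * proj_variance P th `^ (- 2^-1).
Proof.
rewrite /Ncal (mean_cdt_radon rho P K rho1 PK) (std_cdt_radon rho P K rho1 PK).
rewrite powRN powR12_sqrt//.
by apply: Rintegral_ge0 => x _; exact: sqr_ge0.
Qed.

Lemma circ_sqr (al : R) : (circ al).1 ^+ 2 + (circ al).2 ^+ 2 = 1.
Proof. exact: cos2Dsin2. Qed.

Lemma circ_norm1 (al : R) : `|(circ al).1| <= 1 /\ `|(circ al).2| <= 1.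
Proof. by split; rewrite /circ/= ler_norml ?cos_geN1 ?cos_le1 ?sin_geN1 ?sin_le1. Qed.

(** The factor 2 bounds [|cos al| + |sin al|], so one interval serves all angles. *)
Lemma radon_prob_itv al : radon_prob P (circ al) `[- (K * 2), K * 2]%classic = 1%E.
Proof.
apply/eqP; rewrite eq_le probability_le1//= -PK.
have mS : measurable (Sproj (circ al) @^-1` `[- (K * 2), K * 2]%classic).
  by rewrite -[X in measurable X]setTI; exact: measurable_Sproj.
rewrite le_measure ?inE//; first exact: measurable_square.
move=> x Kx /=; rewrite in_itv/= -ler_norml.
rewrite (le_trans (bounded_Sproj _ (circ al) _ Kx))//.
have K0 : 0 <= K by exact: le_trans (bounded_fst _ _ Kx).
by apply: ler_wpM2l => //; have [] := circ_norm1 al; lra.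
Qed.

Lemma cdt_radon_bound t al : cdf_interior rho t ->
  `|cdt rho (radon P (circ al)) t| <= K * 2.
Proof.
by move=> it; rewrite ler_norml (ginv_bounds (radon_prob P (circ al)))// radon_prob_itv.
Qed.

(** Uniformity in [t] is the point: the functions N[P](t, .) form one bounded family, to which a
    boundedness-preserving [h] can be applied. *)
Lemma Ncal_bound : exists C : R, forall t al, cdf_interior rho t ->
  `|Ncal rho P t (circ al)| <= C.
Proof.
have [k k0 kv] := proj_variance_lower_bound P K PK nline.
exists ((K * 2 + (`|(bary P).1| + `|(bary P).2|)) * k `^ (- 2^-1)) => t al it.
rewrite NcalE normrM; apply: ler_pM => //.
  rewrite (le_trans (ler_normB _ _))// lerD ?cdt_radon_bound//.
  rewrite (le_trans (ler_normD _ _))// !normrM.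
  have [c1 s1] := circ_norm1 al.
  by rewrite lerD// -[leRHS]mulr1 ler_wpM2l.
have vk := kv _ (circ_sqr al).
rewrite ger0_norm ?powR_ge0// !powRN lef_pV2 ?posrE ?powR_gt0//;
  last exact: lt_le_trans vk.
by rewrite ge0_ler_powR ?invr_ge0// nnegrE ltW//; exact: lt_le_trans vk.
Qed.

Lemma measurable_circ : measurable_fun setT (@circ R).
Proof.
apply: measurable_fun_pair; apply: continuous_measurable_fun.
  exact: continuous_cos.
exact: continuous_sin.
Qed.

(** The value at [al] is the [P]-measure of the section at [al] of the measurable set [A], and
    measures of sections are measurable. *)
Lemma measurable_cdf_radon s :
  measurable_fun setT (fun al => Defs.cdf (radon_prob P (circ al)) s).
Proof.
pose A : set (R * (R * R)) := [set z | Sproj (circ z.1) z.2 <= s].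
have mA : measurable A.
  have mf : measurable_fun setT (fun z : R * (R * R) => Sproj (circ z.1) z.2).
    have mc : measurable_fun setT (fun z : R * (R * R) => circ z.1).
      exact: measurableT_comp measurable_circ measurable_fst.
    have mx : measurable_fun setT (fun z : R * (R * R) => z.2) := measurable_snd.
    have m1 : measurable_fun setT (fun z : R * (R * R) => z.2.1 * (circ z.1).1).
      by apply: measurable_funM; exact: measurableT_comp measurable_fst _.
    have m2 : measurable_fun setT (fun z : R * (R * R) => z.2.2 * (circ z.1).2).
      by apply: measurable_funM; exact: measurableT_comp measurable_snd _.
    exact: measurable_funD m1 m2.
  rewrite -[X in measurable X]setTI.
  rewrite (_ : A = (fun z : R * (R * R) => Sproj (circ z.1) z.2) @^-1` `]-oo, s]%classic).
    by apply: mf.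
  by apply/seteqP; split => z; rewrite /A/= in_itv.
have mx := measurable_fun_xsection P mA.
apply: (eq_measurable_fun (fine \o (P \o xsection A))).
  move=> al _ /=; congr (fine (P _)); apply/seteqP; split => x; rewrite /xsection/= inE//.
by apply: measurableT_comp => //.
Qed.

Lemma measurable_Ncal t : cdf_interior rho t ->
  measurable_fun setT (Ncal rho P t \o @circ R).
Proof.
move=> it.
have mc : measurable_fun setT (fun al : R => (circ al).1)
  by exact: measurableT_comp measurable_circ.
have ms : measurable_fun setT (fun al : R => (circ al).2)
  by exact: measurableT_comp measurable_circ.
rewrite (_ : _ \o _ = fun al => (cdt rho (radon P (circ al)) t -
  Sproj (circ al) (bary P)) * proj_variance P (circ al) `^ (- 2^-1)); last first.
  by apply/funext => al; exact: NcalE.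
apply: measurable_funM.
  apply: measurable_funB.
    apply: (measurable_fun_ginv _ _ _ (fun al => radon_prob P (circ al))
      (fun=> Defs.cdf rho t)) => //.
    exact: measurable_cdf_radon.
  by apply: measurable_funD; exact: measurable_funM.
apply: (measurableT_comp (measurable_powR _)).
have [a [b [c Q]]] := proj_variance_quadratic P K PK.
under eq_fun do rewrite Q.
by repeat (apply: measurable_funD || apply: measurable_funM ||
  apply: measurable_funX || exact: measurable_cst).
Qed.

Lemma LinfS1_Ncal t : cdf_interior rho t -> LinfS1 (Ncal rho P t).
Proof.
move=> it; split; first exact: measurable_Ncal.
by have [C hC] := Ncal_bound; exists C; apply: aeW => al; exact: hC.
Qed.

End normalized_rcdt.

(** * Affine equivariance *)

Section affine_maps.
Context {R : realType}.

Lemma continuous_affine2 (a b c d y1 y2 : R) : continuous (affine2 a b c d y1 y2).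
Proof.
have cl (u v w : R) : continuous (fun x : R * R => u * x.1 + v * x.2 + w).
  move=> x; apply: cvgD; last exact: cvg_cst.
  by apply: cvgD; apply: cvgM; try exact: cvg_cst; [exact: cvg_fst|exact: cvg_snd].
by move=> x; exact: (cvg_pair (cl a b y1 x) (cl c d y2 x)).
Qed.

Lemma measurable_affine2 (a b c d y1 y2 : R) : measurable_fun setT (affine2 a b c d y1 y2).
Proof.
apply: measurable_fun_pair; apply: measurable_funD => //;
  by apply: measurable_funD; exact: measurable_funM.
Qed.

HB.instance Definition _ a b c d y1 y2 := isMeasurableFun.Build _ _ _ _
  (affine2 a b c d y1 y2) (measurable_affine2 a b c d y1 y2).

Definition affine_push (P : probability (R * R)%type R) a b c d y1 y2 :
  probability (R * R)%type R := distribution P (affine2 a b c d y1 y2).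

Lemma affine2_inv (a b c d y1 y2 : R) : a * d - b * c != 0 ->
  exists a' b' c' d' z1 z2 : R,
    cancel (affine2 a b c d y1 y2) (affine2 a' b' c' d' z1 z2) /\
    cancel (affine2 a' b' c' d' z1 z2) (affine2 a b c d y1 y2).
Proof.
set D := a * d - b * c => D0.
exists (d / D), (- b / D), (- c / D), (a / D),
  ((b * y2 - d * y1) / D), ((c * y1 - a * y2) / D).
by split=> -[u v]; rewrite /affine2/=; congr pair; rewrite /D; field.
Qed.

Lemma supp_affine (mu : set (R * R) -> \bar R) (a b c d y1 y2 : R) :
  a * d - b * c != 0 ->
  supp (fun A => mu (affine2 a b c d y1 y2 @^-1` A)) = affine2 a b c d y1 y2 @` supp mu.
Proof.
move=> D0; have [a' [b' [c' [d' [z1 [z2 [fK gK]]]]]]] := affine2_inv _ _ _ _ y1 y2 D0.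
set f := affine2 a b c d y1 y2; set g := affine2 a' b' c' d' z1 z2.
apply/seteqP; split => [x sx|_ [y sy <-] U oU Uy].
  exists (g x); last exact: gK.
  move=> U oU Ux; have -> : U = f @^-1` (g @^-1` U).
    by apply/seteqP; split => z /=; rewrite /f /g fK.
  by apply: sx => //; apply: open_comp => // z _; exact: continuous_affine2.
by apply: sy => //; apply: open_comp => // z _; exact: continuous_affine2.
Qed.

Lemma affine_orbit_Pcstar (mu : set (R * R) -> \bar R) :
  Pcstar mu -> affine_orbit mu `<=` @Pcstar R.
Proof.
move=> [[P Pmu] cs nl] _ [a [b [c [d [y1 [y2 [D0 ->]]]]]]]; split.
- by exists (affine_push P a b c d y1 y2) => A; rewrite -Pmu.
- rewrite supp_affine//; apply: continuous_compact => //.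
  by apply: continuous_subspaceT; exact: continuous_affine2.
move=> [p [q [r [pq0]]]]; rewrite supp_affine// => sl; apply: nl.
(* The preimage of the line under x -> A x + y: its normal vector is A^T (p, q), nonzero because A
   is invertible. *)
exists (p * a + q * c), (p * b + q * d), (r - p * y1 - q * y2); split.
  apply: contra pq0; rewrite !xpair_eqE => /andP[/eqP e1 /eqP e2].
  have p0 : p * (a * d - b * c) = 0.
    rewrite (_ : _ * _ = (p * a + q * c) * d - (p * b + q * d) * c);
    last by ring.
    by rewrite e1 e2 !mul0r subr0.
  have q0 : q * (a * d - b * c) = 0.
    rewrite (_ : _ * _ = (p * b + q * d) * a - (p * a + q * c) * b);
    last by ring.
    by rewrite e1 e2 !mul0r subr0.
  move/eqP : p0; move/eqP : q0.
  by rewrite !mulf_eq0 (negbTE D0) !orbF => -> ->.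
move=> x sx; have := sl _ (ex_intro2 _ _ x sx erefl).
by rewrite /line2 /affine2/= => <-; ring.
Qed.

(** The norm of A^T theta, that is, the denominator in [phiA]. *)
Definition transpose_norm (a b c d : R) (th : R * R) : R :=
  Num.sqrt ((a * th.1 + c * th.2) ^+ 2 + (b * th.1 + d * th.2) ^+ 2).

Lemma transpose_norm_gt0 (a b c d : R) th : a * d - b * c != 0 ->
  th.1 ^+ 2 + th.2 ^+ 2 = 1 -> 0 < transpose_norm a b c d th.
Proof.
move=> D0 th1; rewrite sqrtr_gt0 lt0r addr_ge0 ?sqr_ge0// andbT.
rewrite paddr_eq0 ?sqr_ge0// !sqrf_eq0; apply/negP => /andP[/eqP e1 /eqP e2].
have /eqP : (a * d - b * c) * th.1 = 0.
  rewrite (_ : _ * _ = d * (a * th.1 + c * th.2) - c * (b * th.1 + d * th.2));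
    last by ring.
  by rewrite e1 e2 !mulr0 subr0.
have /eqP : (a * d - b * c) * th.2 = 0.
  rewrite (_ : _ * _ = a * (b * th.1 + d * th.2) - b * (a * th.1 + c * th.2));
    last by ring.
  by rewrite e1 e2 !mulr0 subr0.
rewrite !mulf_eq0 (negbTE D0)/= => /eqP h2 /eqP h1; move: th1.
by rewrite h1 h2 expr0n/= addr0 => /esym/eqP; rewrite oner_eq0.
Qed.

Lemma Sproj_affine2 (a b c d y1 y2 : R) th x : 0 < transpose_norm a b c d th ->
  Sproj th (affine2 a b c d y1 y2 x) =
  transpose_norm a b c d th * Sproj (phiA a b c d th) x + Sproj th (y1, y2).
Proof.
move=> n0; rewrite /Sproj /phiA /affine2/= -/(transpose_norm a b c d th).
by field; exact: lt0r_neq0.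
Qed.

End affine_maps.

Section equivariance.
Context {R : realType} (rho : probability R R) (P : probability (R * R)%type R).
Variables (K K' a b c d y1 y2 : R).
Hypothesis rho1 : forall x, rho [set x] = 0%E.
Hypothesis D0 : a * d - b * c != 0.
Let P' := affine_push P a b c d y1 y2.
Hypothesis PK : P (square K) = 1%E.
Hypothesis PK' : P' (square K') = 1%E.
Variable th : R * R.
Hypothesis th1 : th.1 ^+ 2 + th.2 ^+ 2 = 1.
Let n := transpose_norm a b c d th.
Let k := Sproj th (y1, y2).
Let th' := phiA a b c d th.

Let n0 : 0 < n.
Proof. exact: transpose_norm_gt0. Qed.

Lemma cdf_radon_affine s :
  Defs.cdf (radon_prob P' th) s = Defs.cdf (radon_prob P th') ((s - k) / n).
Proof.
congr (fine (P _)); apply/seteqP; split => x /=; rewrite (Sproj_affine2 _ _ _ _ _ _ _ _ n0);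
  by rewrite ler_pdivlMr// lerBrDr mulrC.
Qed.

Lemma cdt_radon_affine t : cdf_interior rho t ->
  cdt rho (radon P' th) t = n * cdt rho (radon P th') t + k.
Proof.
move=> it.
(* Two reals with the same strict upper bounds are equal; in this form [ginv_ltP] applies to both
   sides. *)
suff lts r : cdt rho (radon P' th) t < r <-> n * cdt rho (radon P th') t + k < r.
  apply/eqP; rewrite eq_le; apply/andP; split; rewrite leNgt; apply/negP.
    by move/lts; rewrite ltxx.
  by move/lts; rewrite ltxx.
rewrite (ginv_ltP (radon_prob P' th) _ _ it) -ltrBrDr mulrC -ltr_pdivlMr//.
rewrite (ginv_ltP (radon_prob P th') _ _ it); split => -[s sr ts].
  exists ((s - k) / n); last by rewrite -cdf_radon_affine.
  by rewrite ltr_pM2r ?invr_gt0// ltrD2r.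
exists (n * s + k).
  by rewrite -ltrBrDr mulrC -ltr_pdivlMr.
by rewrite cdf_radon_affine addrK mulrC mulKf// gt_eqF.
Qed.

Lemma Rintegral_affine_push (f : R * R -> R) : measurable_fun setT f ->
  P'.-integrable setT (EFin \o f) ->
  \int[P']_x f x = \int[P]_x f (affine2 a b c d y1 y2 x).
Proof.
move=> mf /integrableP[mf' fi].
rewrite /Rintegral /P' /affine_push integral_distribution//.
apply/integrableP; split; first by apply: measurableT_comp.
rewrite -(ge0_integral_distribution (affine2 a b c d y1 y2) (f := abse \o (EFin \o f)))//.
  exact: measurableT_comp.
by move=> y; exact: abse_ge0.
Qed.

Lemma bary_affine : Sproj th (bary P') = n * Sproj th' (bary P) + k.
Proof.
rewrite -(Rintegral_Sproj P' K' PK') Rintegral_affine_push; last 2 first.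
- exact: measurable_Sproj.
- exact: integrable_Sproj PK' th.
under eq_Rintegral do rewrite (Sproj_affine2 _ _ _ _ _ _ _ _ n0).
have i1 := integrable_Sproj P K PK th'.
rewrite RintegralD//; last 2 first.
- exact: (integrableZl measurableT n i1).
- by apply: finite_measure_integrable_cst.
rewrite RintegralZl// (Rintegral_Sproj P K PK) Rintegral_cst//.
by rewrite [X in _ * fine X]probability_setT mulr1.
Qed.

Lemma proj_variance_affine : proj_variance P' th = n ^+ 2 * proj_variance P th'.
Proof.
rewrite /proj_variance Rintegral_affine_push; last 2 first.
- exact: measurable_sqr_dev (measurable_Sproj th).
- exact: integrable_dev PK' th.
rewrite -RintegralZl//; last exact: integrable_dev PK th'.
apply: eq_Rintegral => x _; rewrite (Sproj_affine2 _ _ _ _ _ _ _ _ n0) bary_affine.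
by rewrite -/n -/th' -/k; ring.
Qed.

(** Centring removes the shift [k], and the positive factor [n] cancels between the CDT and its
    standard deviation. *)
Lemma Ncal_affine t : cdf_interior rho t -> Ncal rho P' t th = Ncal rho P t th'.
Proof.
move=> it; rewrite /Ncal.
rewrite (mean_cdt_radon rho P' K' rho1 PK') (std_cdt_radon rho P' K' rho1 PK').
rewrite (mean_cdt_radon rho P K rho1 PK) (std_cdt_radon rho P K rho1 PK).
rewrite cdt_radon_affine// bary_affine proj_variance_affine.
rewrite sqrtrM ?sqr_ge0// sqrtr_sqr gtr0_norm// opprD addrACA subrr addr0 -mulrBr.
by rewrite -mulf_div divff ?mul1r// gt_eqF.
Qed.

End equivariance.

(** * Separation in L^infty *)

Section ultralimit.
Context {R : realType} (rho : probability R R).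

Variable U : set_system R.
Hypothesis UU : UltraFilter U.
Hypothesis aeU : forall A, {ae rho, forall t, A t} -> U A.

Let PU : ProperFilter U.
Proof. exact: ultra_proper. Qed.

(** [U] contains the conull sets, so the image ultrafilter contains the compact segment [[- M, M]]
    and converges. Measurability of [f] does not enter. *)
Lemma ultralimit_cvg (f : R -> R) : Linf_rho rho f -> cvg (f t @[t --> U]).
Proof.
move=> [M fM]; pose G := f t @[t --> U].
have PG : ProperFilter G by exact: fmap_proper_filter.
have UG : UltraFilter G.
  (* Maximality of the image filter: if a finer [H] contained some [A] outside it, [H] would also
     contain the complement of [A]. *)
  split=> // H PH GH; apply/seteqP; split => // A HA.
  have [//|UnA] := in_ultra_setVsetC (f @^-1` A) UU.
  exfalso; apply: (@filter_not_empty _ H) => //.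
  by rewrite -(setICr A); apply: filterI => //; exact: GH.
have : compact `[- M, M]%classic by exact: segment_compact.
rewrite compact_ultra => /(_ G UG)[|l [_ Gl]].
  apply: (@filterS _ U _ (fun t => `|f t| <= M)); last exact: aeU.
  by move=> t /= tM; rewrite in_itv/= -ler_norml.
by apply/cvg_ex; exists l.
Qed.

Lemma ultralimit_functional :
  cont_lin_functional rho (fun f => lim (f t @[t --> U])).
Proof.
split.
- move=> f g _ _ fg; have Ufg : U (fun t => f t = g t) by exact: aeU.
  congr lim; apply/seteqP; split => A /= UA.
    by apply: filterS2 Ufg UA => t /= ->.
  by apply: filterS2 Ufg UA => t /= ->.
- move=> k f g /ultralimit_cvg cf /ultralimit_cvg cg.
  apply/cvg_lim => //; apply: cvgD => //; exact: cvgMr.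
- exists 1 => f M fM; rewrite mul1r.
  have cf : cvg (f t @[t --> U]) by apply: ultralimit_cvg; exists M.
  have UM : U (fun t => `|f t| <= M) by exact: aeU.
  rewrite ler_norml; apply/andP; split.
    apply: limr_ge => //; apply: filterS UM => t.
    by rewrite ler_norml => /andP[].
  apply: limr_le => //; apply: filterS UM => t.
  by rewrite ler_norml => /andP[].
Qed.

End ultralimit.

Lemma lin_functionalN {R : realType} (rho : probability R R) l :
  cont_lin_functional rho l -> cont_lin_functional rho (fun f => - l f).
Proof.
move=> [lae llin [C lC]]; split.
- by move=> f g bf bg fg; rewrite (lae f g).
- by move=> k f g bf bg; rewrite llin//; ring.
- by exists C => f M fM; rewrite normrN; exact: lC.
Qed.

Lemma Linf_separation {R : realType} (rho : probability R R) (f g : R -> R) :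
  Linf_rho rho f -> Linf_rho rho g -> ~ {ae rho, forall t, f t = g t} ->
  exists l (c : R), [/\ cont_lin_functional rho l, c < l f & l g < c].
Proof.
move=> bf bg nfg.
suff [l ll lfg] : exists2 l, cont_lin_functional rho l & l f != l g.
  move: lfg; rewrite neq_lt => /orP[lfg|lfg].
    exists (fun f => - l f), (- ((l f + l g) / 2)); split; [|lra|lra].
    exact: lin_functionalN.
  by exists l, ((l f + l g) / 2); split => //; lra.
pose E n := [set t | n.+1%:R^-1 <= `|f t - g t|].
(* The sets [E n] exhaust the points where [f] and [g] differ; were all of them negligible, [f] and
   [g] would agree almost everywhere. *)
have [n En] : exists n, ~ rho.-negligible (E n).
  apply/existsNP => En; apply: nfg.
  apply: negligibleS (negligible_bigcup En) => t /= /eqP; rewrite -subr_eq0 -normr_gt0.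
  move=> /ltr_add_invr[n]; rewrite add0r => /ltW ?; by exists n.
(* The filter generated by the conull sets and [E n]; it is proper precisely because [E n] is not
   negligible. *)
pose F := within (E n) (almost_everywhere rho).
have PF : ProperFilter F.
  split; last exact: within_filter.
  move=> /= F0; apply: En; apply: negligibleS F0 => t Et /= /(_ Et) [].
have [U [UU FU]] := ultraFilterLemma PF.
have PU : ProperFilter U by exact: ultra_proper.
have aeU A : {ae rho, forall t, A t} -> U A.
  by move=> aeA; apply: FU; apply: filterS aeA.
exists (fun f => lim (f t @[t --> U])); first exact: ultralimit_functional.
have cf := ultralimit_cvg rho U UU aeU f bf.
have cg := ultralimit_cvg rho U UU aeU g bg.
(* The bound [|f - g| >= 1/(n+1)] holds on [E n], a member of [U], and therefore passes to the
   limits. *)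
rewrite -subr_eq0 -normr_gt0 (@lt_le_trans _ _ n.+1%:R^-1) ?invr_gt0//.
have cfg : `|f t - g t| @[t --> U] --> `|lim (f t @[t --> U]) - lim (g t @[t --> U])|.
  by apply: cvg_norm; apply: cvgB.
rewrite -(cvg_lim _ cfg)//; apply: limr_ge; first by apply/cvg_ex; eexists; exact: cfg.
have UE : U (E n).
  by apply: FU; rewrite /F /within /prop_near1 /=; apply: aeW => t.
exact: filterS UE.
Qed.

(** * The h-normalized R-CDT on affine orbits *)

Section normalization.
Context {R : realType} (rho : probability R R) (h : (R * R -> R) -> R).
Hypothesis rho1 : forall x, rho [set x] = 0%E.

Lemma Linf_Nh (mu : set (R * R) -> \bar R) :
  bdd_preserving h -> Pcstar mu -> Linf_rho rho (Nh h rho mu).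
Proof.
move=> hb [[P Pmu] cs nl]; have {Pmu} ? : mu = P by apply/funext => A.
subst mu; have [K PK] := compact_supp_square P cs.
have [C NC] := Ncal_bound rho P K rho1 PK nl.
have [||M hM] := hb [set Ncal rho P t | t in cdf_interior rho].
- by move=> _ [t it <-]; exact: LinfS1_Ncal rho1 PK nl t it.
- by exists C => _ [t it <-]; apply: aeW => al; exact: NC.
exists M; apply: filterS (ae_cdf_interior rho rho1) => t it.
by apply: hM; exists t.
Qed.

Lemma Nh_affine_orbit (mu nu : set (R * R) -> \bar R) :
  wd_on_LinfS1 h -> GL2_invariant h -> Pcstar mu -> affine_orbit mu nu ->
  {ae rho, forall t, Nh h rho nu t = Nh h rho mu t}.
Proof.
move=> hwd hGL Pc onu; have := affine_orbit_Pcstar mu Pc nu onu.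
case: Pc onu => [[P Pmu] cs nl] [a [b [c [d [y1 [y2 [D0 ->]]]]]]].
have {Pmu} ? : mu = P by apply/funext => A.
subst mu; rewrite -[fun A => _]/(affine_push P a b c d y1 y2 : set _ -> \bar R).
move=> [_ cs' nl'].
have [K PK] := compact_supp_square P cs.
have [K' PK'] := compact_supp_square _ cs'.
apply: filterS (ae_cdf_interior rho rho1) => t it.
have L1 := LinfS1_Ncal rho P K rho1 PK nl t it.
have L2 := LinfS1_Ncal rho _ K' rho1 PK' nl' t it.
have eqN al : Ncal rho (affine_push P a b c d y1 y2) t (circ al) =
    (Ncal rho P t \o phiA a b c d) (circ al).
  exact: (Ncal_affine rho P K K' a b c d y1 y2 rho1 D0 PK PK' _
    (circ_sqr al) t it).
apply: etrans (hGL _ a b c d L1 D0).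
(* The two functions are known to agree only on the circle, so equality of their values under [h]
   comes from [hwd]. *)
apply: (hwd _ _ L2); last exact: aeW.
case: (L2) => mN _; have [C NC] := Ncal_bound rho _ K' rho1 PK' nl'; split.
  by apply: eq_measurable_fun mN => al _; exact: eqN.
by exists C; apply: aeW => al; rewrite -eqN; exact: NC.
Qed.

End normalization.

Theorem theorem12 (R : realType) (rho : probability R R)
    (h : (R * R -> R) -> R) (mu0 nu0 : set (R * R) -> \bar R) :
  (forall x : R, rho [set x] = 0%E) ->
  wd_on_LinfS1 h -> bdd_preserving h -> GL2_invariant h ->
  Pcstar mu0 -> Pcstar nu0 ->
  ~ {ae rho, forall t : R, Nh h rho mu0 t = Nh h rho nu0 t} ->
  (affine_orbit mu0 `<=` @Pcstar R) /\ (affine_orbit nu0 `<=` @Pcstar R) /\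
  (forall mu, (affine_orbit mu0 `|` affine_orbit nu0) mu ->
     Linf_rho rho (Nh h rho mu)) /\
  lin_separable rho (Nh h rho @` affine_orbit mu0) (Nh h rho @` affine_orbit nu0).
Proof.
move=> rho1 hwd hb hGL Pmu Pnu neq.
have Omu := affine_orbit_Pcstar mu0 Pmu; have Onu := affine_orbit_Pcstar nu0 Pnu.
have Linf mu : (affine_orbit mu0 `|` affine_orbit nu0) mu ->
    Linf_rho rho (Nh h rho mu).
  by case=> [/Omu|/Onu]; exact: Linf_Nh.
split=> //; split=> //; split=> //.
have Lmu := Linf_Nh rho h rho1 mu0 hb Pmu.
have Lnu := Linf_Nh rho h rho1 nu0 hb Pnu.
have [l [c [ll lmu lnu]]] := Linf_separation rho _ _ Lmu Lnu neq.
exists l, c; split; first exact: ll.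
(* Up to rho-null sets each orbit has a single image, and [l] respects almost everywhere equality;
   the strict inequalities at [mu0] and [nu0] thus extend to whole orbits. *)
have [lae _ _] := ll; split=> _ [mu omu <-].
  apply: (eq_ind_r (fun r => c < r) lmu); apply: lae.
  - by apply: Linf; left.
  - exact: Lmu.
  - exact: Nh_affine_orbit omu.
apply: (eq_ind_r (fun r => r < c) lnu); apply: lae.
- by apply: Linf; right.
- exact: Lnu.
- exact: Nh_affine_orbit omu.
Qed.
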